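(* Consider the linear regression model, kernel matrix $P=P(\eta)$, cost functions and notation described in the context, and assume: (A1) the minimizers $\hat\eta_{\mathrm{EB}},\hat\eta_{\mathrm{Sy}},\hat\eta_{\mathrm{EEB}},\hat\eta_{\mathrm{MSEy}}$ (defined in the context) are interior points of $\Omega$; (A2) $P$ is positive definite and $\Phi^T\Phi/N\to\Sigma$ almost surely as $N\to\infty$, with $\Sigma\in\mathbb{R}^{n\times n}$ positive definite; (A3) the sets of minimizers $\eta_b^*$ of $W_b$ and $\eta_y^*$ of $W_y$ over $\Omega$ each consist of isolated points; (A4) $\|\Phi^T\Phi/N-\Sigma\|_F=O_p(\delta_N)$, where $\delta_N\to0$ as $N\to\infty$. Write $\Delta=\Phi^T\Phi/N-\Sigma$ and $r_2=\operatorname{rank}(\Sigma^{-1}P^{-1}-N(\Phi^T\Phi)^{-1}S^{-1})$. Then $$|\overline{\mathcal F}_{\mathrm{Sy}}-W_y|\le E_{1,y}+E_{2,y}+E_{3,y}+E_{4,y}+E_{5,y},$$ where $$E_{1,y}=\sigma^4\|\theta_0\|_2\|\Phi^TV\|_2\|(\Phi^T\Phi)^{-1}\|_F\left(N\|(\Phi^T\Phi)^{-1}\|_F\|S^{-1}\|_F^2+\|\Sigma^{-1}\|_F\|P^{-1}\|_F^2\right),$$ $$E_{2,y}=\sigma^4N\|(\Phi^T\Phi)^{-1}\|_F\|\Delta\|_F\|\Sigma^{-1}\|_F\|P^{-1}\|_F\left(\|\theta_0\|_2^2\|S^{-1}\|_F+2\sqrt{r_2}\right),$$ $$E_{3,y}=\sigma^4\|(\Phi^T\Phi)^{-1}\|_F\|S^{-1}\|_F\Big(\|\Phi^TV\|_2^2N\|(\Phi^T\Phi)^{-1}\|_F^2\|S^{-1}\|_F+\sigma^2\|\theta_0\|_2^2N\|(\Phi^T\Phi)^{-1}\|_F\|S^{-1}\|_F\|P^{-1}\|_F+\sigma^2\|\theta_0\|_2^2\|\Sigma^{-1}\|_F\|P^{-1}\|_F^2+2\sqrt{r_2}\,\sigma^2N\|(\Phi^T\Phi)^{-1}\|_F\|P^{-1}\|_F\Big),$$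 $$E_{4,y}=\sigma^6\|\theta_0\|_2\|\Phi^TV\|_2\|(\Phi^T\Phi)^{-1}\|_F^2\|S^{-1}\|_F\|P^{-1}\|_F\left(N\|(\Phi^T\Phi)^{-1}\|_F\|S^{-1}\|_F+\|\Sigma^{-1}\|_F\|P^{-1}\|_F\right),$$ $$E_{5,y}=\sigma^4\|\theta_0\|_2\|\Phi^TV\|_2N\|(\Phi^T\Phi)^{-1}\|_F^2\|\Delta\|_F\|\Sigma^{-1}\|_F\|S^{-1}\|_F\|P^{-1}\|_F.$$ Moreover, these terms have the upper bounds $$E_{1,y}\le\frac1{\sqrt N}n^2\sigma^4\|\theta_0\|_2\frac{N}{\lambda_1(\Phi^T\Phi)}\operatorname{cond}(\Phi^T\Phi)\frac{\|\Phi^TV\|_2}{\sqrt N}\left(\frac{N}{\lambda_1(\Phi^T\Phi)}\frac1{\lambda_1^2(S)}\operatorname{cond}(\Phi^T\Phi)\operatorname{cond}^2(S)+\frac1{\lambda_1(\Sigma)}\frac1{\lambda_1^2(P)}\operatorname{cond}(\Sigma)\operatorname{cond}^2(P)\right),$$ $$E_{2,y}\le\delta_Nn^2\sigma^4\frac{N}{\lambda_1(\Phi^T\Phi)}\frac{\lambda_n(\Delta)}{\delta_N}\frac1{\lambda_1(\Sigma)}\frac1{\lambda_1(P)}\operatorname{cond}(\Phi^T\Phi)\operatorname{cond}(\Delta)\operatorname{cond}(\Sigma)\operatorname{cond}(P)\left(\sqrt n\|\theta_0\|_2^2\frac{1}{\lambda_1(S)}\operatorname{cond}(S)+2\sqrt{r_2}\right),$$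 $$E_{3,y}\le\frac1Nn^2\sigma^4\frac{N}{\lambda_1(\Phi^T\Phi)}\frac1{\lambda_1(S)}\operatorname{cond}(\Phi^T\Phi)\operatorname{cond}(S)\Bigg[\sqrt n\frac{\|\Phi^TV\|_2^2}{N}\left(\frac{N}{\lambda_1(\Phi^T\Phi)}\right)^2\frac1{\lambda_1(S)}\operatorname{cond}^2(\Phi^T\Phi)\operatorname{cond}(S)$$ $$\qquad+\sqrt n\,\sigma^2\|\theta_0\|_2^2\frac{N}{\lambda_1(\Phi^T\Phi)}\frac1{\lambda_1(S)}\frac1{\lambda_1(P)}\operatorname{cond}(\Phi^T\Phi)\operatorname{cond}(S)\operatorname{cond}(P)+\sqrt n\,\sigma^2\|\theta_0\|_2^2\frac1{\lambda_1(\Sigma)}\frac1{\lambda_1^2(P)}\operatorname{cond}(\Sigma)\operatorname{cond}^2(P)$$ $$\qquad+2\sqrt{r_2}\,\sigma^2\frac{N}{\lambda_1(\Phi^T\Phi)}\frac1{\lambda_1(P)}\operatorname{cond}(\Phi^T\Phi)\operatorname{cond}(P)\Bigg],$$ $$E_{4,y}\le\frac1{N^{3/2}}\sigma^6n^3\|\theta_0\|_2\left(\frac{N}{\lambda_1(\Phi^T\Phi)}\right)^2\frac1{\lambda_1(S)}\frac1{\lambda_1(P)}\operatorname{cond}^2(\Phi^T\Phi)\operatorname{cond}(S)\operatorname{cond}(P)\frac{\|\Phi^TV\|_2}{\sqrt N}\left(\frac{N}{\lambda_1(\Phi^T\Phi)}\frac1{\lambda_1(S)}\operatorname{cond}(\Phi^T\Phi)\operatorname{cond}(S)+\frac1{\lambda_1(\Sigma)}\frac1{\lambda_1(P)}\operatorname{cond}(\Sigma)\operatorname{cond}(P)\right),$$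 $$E_{5,y}\le\frac{\delta_N}{\sqrt N}\sigma^4n^3\|\theta_0\|_2\left(\frac{N}{\lambda_1(\Phi^T\Phi)}\right)^2\frac{\lambda_n(\Delta)}{\delta_N}\frac1{\lambda_1(\Sigma)}\frac1{\lambda_1(S)}\frac1{\lambda_1(P)}\operatorname{cond}^2(\Phi^T\Phi)\operatorname{cond}(\Delta)\operatorname{cond}(\Sigma)\operatorname{cond}(S)\operatorname{cond}(P)\frac{\|\Phi^TV\|_2}{\sqrt N}.$$
   Context: Model: $Y=\Phi\theta_0+V$, with $Y\in\mathbb{R}^N$, $\Phi\in\mathbb{R}^{N\times n}$ of full column rank $n$, $N>n$, true parameter $\theta_0\in\mathbb{R}^n$, and $V\in\mathbb{R}^N$ having i.i.d. entries of mean $0$ and variance $\sigma^2>0$. Dependence on $N$ is suppressed in the notation. Kernel matrix: $P=P(\eta)\in\mathbb{R}^{n\times n}$ is a (symmetric) kernel matrix parameterized by a hyper-parameter $\eta\in\Omega\subset\mathbb{R}^p$. Notation: $\hat\theta^{\mathrm{LS}}=(\Phi^T\Phi)^{-1}\Phi^TY$, $Q=\Phi P\Phi^T+\sigma^2I_N$, $S=P+\sigma^2(\Phi^T\Phi)^{-1}$, $\hat\theta^{\mathrm R}(\eta)=P\Phi^TQ^{-1}Y$. $\|\cdot\|_2$ is the Euclidean norm, $\|\cdot\|_F$ the Frobenius norm. For a positive definite $n\times n$ matrix ($n\ge2$), $\lambda_1(\cdot)\ge\dots\ge\lambda_n(\cdot)$ are its eigenvalues and $\operatorname{cond}(\cdot)=\lambda_1(\cdot)/\lambda_n(\cdot)$;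 the same symbols $\lambda_n(\cdot)$ and $\operatorname{cond}(\cdot)$ are also applied to the symmetric matrix $\Delta=\Phi^T\Phi/N-\Sigma$. $\xi_N=O_p(a_N)$ means: for every $\epsilon>0$ there is $L>0$ with $\mathbb P(|\xi_N/a_N|>L)<\epsilon$ for all $N$. Cost functions and minimizers over $\eta\in\Omega$: - $\hat\eta_{\mathrm{EB}}$ minimizes $\mathcal F_{\mathrm{EB}}=Y^TQ^{-1}Y+\log\det Q$; - $\hat\eta_{\mathrm{Sy}}$ minimizes $\mathcal F_{\mathrm{Sy}}=\|Y-\Phi\hat\theta^{\mathrm R}(\eta)\|_2^2+2\sigma^2\operatorname{Tr}(\Phi P\Phi^TQ^{-1})$; - $\hat\eta_{\mathrm{EEB}}$ minimizes $\theta_0^T\Phi^TQ^{-1}\Phi\theta_0+\sigma^2\operatorname{Tr}(Q^{-1})+\log\det Q$; - $\hat\eta_{\mathrm{MSEy}}$ minimizes $\sigma^4\theta_0^T\Phi^TQ^{-2}\Phi\theta_0+\sigma^6\operatorname{Tr}(Q^{-2})-2\sigma^4\operatorname{Tr}(Q^{-1})+2N\sigma^2$. Normalized SURE cost: $\overline{\mathcal F}_{\mathrm{Sy}}=N[\mathcal F_{\mathrm{Sy}}+Y^T\Phi(\Phi^T\Phi)^{-1}\Phi^TY-Y^TY-2n\sigma^2]=N\left[\sigma^4(\hat\theta^{\mathrm{LS}})^TS^{-T}(\Phi^T\Phi)^{-1}S^{-1}\hat\theta^{\mathrm{LS}}-2\sigma^4\operatorname{Tr}((\Phi^T\Phi)^{-1}S^{-1})\right]$.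 Limit functions: $W_b=\theta_0^TP^{-1}\theta_0+\log\det P$ and $W_y=\sigma^4\theta_0^TP^{-T}\Sigma^{-1}P^{-1}\theta_0-2\sigma^4\operatorname{Tr}(\Sigma^{-1}P^{-1})$; $\eta_b^*$, $\eta_y^*$ denote their sets of minimizers over $\eta\in\Omega$.
   Formalization: In the bounds on E_{2,y} and E_{5,y}, the eigenvalues of Δ are ordered by modulus in λ_n(Δ) and cond(Δ), and Δ is assumed nonsingular; with signed ordering the bounds fail, e.g. for Δ = −εI. Also δ_N ≠ 0 is assumed. *)

(* Defs.v *)
(* MathComp-Analysis, over an arbitrary [R : realType]. *)
From HB Require Import structures.
From mathcomp Require Import all_boot all_order all_algebra.
From mathcomp Require Import all_classical all_reals all_analysis.

Set Implicit Arguments.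
Unset Strict Implicit.
Unset Printing Implicit Defensive.

Import Order.TTheory GRing.Theory Num.Theory.
Import numFieldNormedType.Exports.

Local Open Scope classical_set_scope.
Local Open Scope ring_scope.

Section Matrices.
Variable R : realType.

(* On column vectors this is the Euclidean norm. *)
Definition normF m n (A : 'M[R]_(m, n)) : R :=
  Num.sqrt (\sum_i \sum_j A i j ^+ 2).

Definition norm2 m (x : 'cV[R]_m) : R := Num.sqrt (\sum_i x i 0 ^+ 2).

Definition bform m n (x : 'cV[R]_m) (A : 'M[R]_(m, n)) (y : 'cV[R]_n) : R :=
  (x^T *m A *m y) 0 0.

Definition posdef n (A : 'M[R]_n) : Prop :=
  A^T = A /\ forall x : 'cV[R]_n, x != 0 -> 0 < bform x A x.

(* The eigenvalues of A with multiplicity, in decreasing order; this list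
   exists and is unique whenever the characteristic polynomial splits over R,
   in particular for every symmetric A. *)
Definition eigenvalues n (A : 'M[R]_n) : seq R :=
  xget [::] [set s | sorted >=%R s /\
                     char_poly A = \prod_(a <- s) ('X - a%:P)].

(* [lambda A k] is the k-th largest eigenvalue, counted from k = 1. *)
Definition lambda n (A : 'M[R]_n) (k : nat) : R := (eigenvalues A)`_k.-1.

Definition cond n (A : 'M[R]_n) : R := lambda A 1 / lambda A n.

(* Version for symmetric matrices that need not be positive definite: the
   moduli of the eigenvalues (i.e. the singular values) are ordered instead, so
   that [cond_abs A] is the spectral condition number of A when A is
   invertible.  On positive definite matrices [lambda_abs] and [cond_abs] agree
   with [lambda] and [cond]. *)
Definition lambda_abs n (A : 'M[R]_n) (k : nat) : R :=
  (sort >=%R [seq `|a| | a <- eigenvalues A])`_k.-1.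

Definition cond_abs n (A : 'M[R]_n) : R := lambda_abs A 1 / lambda_abs A n.

End Matrices.

Definition minimizers (R : realType) (E : Type) (Omega : set E) (f : E -> R) :
  set E := [set x | Omega x /\ forall y, Omega y -> f x <= f y].

Section Probability.
Context d (T : measurableType d) (R : realType) (Pr : probability T R).

(* Subfamilies of an 'I_N-indexed family are the J : {set 'I_N}. *)
Definition mutually_independent N (X : 'I_N -> {RV Pr >-> R}) : Prop :=
  forall (J : {set 'I_N}) (B : 'I_N -> set R),
    (forall i, measurable (B i)) ->
    Pr [set w | forall i, i \in J -> B i (X i w)] =
    (\prod_(i in J) Pr (X i @^-1` B i))%E.

Definition identically_distributed N (X : 'I_N -> {RV Pr >-> R}) : Prop :=
  forall (i j : 'I_N) (B : set R), measurable B ->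
    distribution Pr (X i) B = distribution Pr (X j) B.

Definition iid_noise N (sigma : R) (X : 'I_N -> {RV Pr >-> R}) : Prop :=
  [/\ mutually_independent X,
      identically_distributed X,
      forall i, ('E_Pr[X i] = 0)%E
    & forall i, ('V_Pr[X i] = (sigma ^+ 2)%:E)%E].

(* [xi N = O_p (a N)], over the sample sizes N > n for which the model with n
   parameters is defined. *)
Definition big_Op (n : nat) (xi : nat -> T -> R) (a : nat -> R) : Prop :=
  forall eps : R, 0 < eps -> exists2 L : R, 0 < L &
    forall N, (n < N)%N -> (Pr [set w | (L < `|xi N w / a N|)%R] < eps%:E)%E.

End Probability.

Section Model.
Variables (R : realType) (N n : nat).
Implicit Types (sigma : R) (theta : 'cV[R]_n) (Phi : 'M[R]_(N, n)).
Implicit Types (P Sigma : 'M[R]_n) (Y V : 'cV[R]_N).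

Definition gram Phi : 'M[R]_n := Phi^T *m Phi.

Definition Qmx sigma Phi P : 'M[R]_N :=
  Phi *m P *m Phi^T + (sigma ^+ 2)%:M.

Definition Smx sigma Phi P : 'M[R]_n :=
  P + sigma ^+ 2 *: invmx (gram Phi).

Definition Delta Phi Sigma : 'M[R]_n := N%:R^-1 *: gram Phi - Sigma.

Definition theta_R sigma Phi P Y : 'cV[R]_n :=
  P *m Phi^T *m invmx (Qmx sigma Phi P) *m Y.

Definition F_EB sigma Phi Y P : R :=
  bform Y (invmx (Qmx sigma Phi P)) Y + ln (\det (Qmx sigma Phi P)).

Definition F_Sy sigma Phi Y P : R :=
  norm2 (Y - Phi *m theta_R sigma Phi P Y) ^+ 2
  + 2 * sigma ^+ 2 * \tr (Phi *m P *m Phi^T *m invmx (Qmx sigma Phi P)).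

Definition F_EEB sigma Phi theta0 P : R :=
  let Qi := invmx (Qmx sigma Phi P) in
  bform theta0 (Phi^T *m Qi *m Phi) theta0 + sigma ^+ 2 * \tr Qi
  + ln (\det (Qmx sigma Phi P)).

Definition F_MSEy sigma Phi theta0 P : R :=
  let Qi := invmx (Qmx sigma Phi P) in
  sigma ^+ 4 * bform theta0 (Phi^T *m (Qi *m Qi) *m Phi) theta0
  + sigma ^+ 6 * \tr (Qi *m Qi) - 2 * sigma ^+ 4 * \tr Qi
  + 2 * N%:R * sigma ^+ 2.

(* Equal to
   N [sigma^4 (theta_LS)^T S^-T (Phi^T Phi)^-1 S^-1 theta_LS
      - 2 sigma^4 Tr ((Phi^T Phi)^-1 S^-1)],
   where theta_LS = (Phi^T Phi)^-1 Phi^T Y. *)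
Definition F_Sy_bar sigma Phi Y P : R :=
  N%:R * (F_Sy sigma Phi Y P
          + bform Y (Phi *m invmx (gram Phi) *m Phi^T) Y
          - bform Y 1%:M Y - 2 * n%:R * sigma ^+ 2).

Definition rank2 sigma Phi Sigma P : nat :=
  \rank (invmx Sigma *m invmx P
         - N%:R *: (invmx (gram Phi) *m invmx (Smx sigma Phi P))).

Section ErrorTerms.
Variables (sigma : R) (theta0 : 'cV[R]_n) (Phi : 'M[R]_(N, n)) (V : 'cV[R]_N).
Variables (Sigma P : 'M[R]_n).
Let th := norm2 theta0.
Let v := norm2 (Phi^T *m V).
Let b := normF (invmx (gram Phi)).
Let s := normF (invmx (Smx sigma Phi P)).
Let c := normF (invmx Sigma).
Let p := normF (invmx P).
Let dl := normF (Delta Phi Sigma).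
Let r := Num.sqrt (rank2 sigma Phi Sigma P)%:R : R.

Definition E1y : R :=
  sigma ^+ 4 * th * v * b * (N%:R * b * s ^+ 2 + c * p ^+ 2).

Definition E2y : R :=
  sigma ^+ 4 * N%:R * b * dl * c * p * (th ^+ 2 * s + 2 * r).

Definition E3y : R :=
  sigma ^+ 4 * b * s *
    (v ^+ 2 * N%:R * b ^+ 2 * s
     + sigma ^+ 2 * th ^+ 2 * N%:R * b * s * p
     + sigma ^+ 2 * th ^+ 2 * c * p ^+ 2
     + 2 * r * sigma ^+ 2 * N%:R * b * p).

Definition E4y : R :=
  sigma ^+ 6 * th * v * b ^+ 2 * s * p * (N%:R * b * s + c * p).

Definition E5y : R :=
  sigma ^+ 4 * th * v * N%:R * b ^+ 2 * dl * c * s * p.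

End ErrorTerms.

End Model.

Section LimitFunctions.
Variables (R : realType) (n : nat).
Implicit Types (theta : 'cV[R]_n) (P Sigma : 'M[R]_n).

Definition W_b theta0 P : R := bform theta0 (invmx P) theta0 + ln (\det P).

Definition W_y (sigma : R) theta0 Sigma P : R :=
  sigma ^+ 4 * bform theta0 ((invmx P)^T *m invmx Sigma *m invmx P) theta0
  - 2 * sigma ^+ 4 * \tr (invmx Sigma *m invmx P).

End LimitFunctions.

(* Main.v *)
(* With x = theta_0, y = (Phi^T Phi)^-1 Phi^T V, M = S^-1 (Phi^T Phi)^-1 S^-1
   and L = P^-1 Sigma^-1 P^-1, the least squares estimate is x + y and, by the
   Woodbury identity, (normalized cost - W_y) / sigma^4 equals
     x^T K x + N x^T M y + (x^T K y + x^T L y) + N y^T M y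
     + 2 Tr (Sigma^-1 P^-1 - N (Phi^T Phi)^-1 S^-1),   K = N M - L,
   where one of the two equal cross terms has been split along N M = K + L.
   K and the matrix in the trace telescope into products having one factor
     S^-1 - P^-1 = - sigma^2 S^-1 (Phi^T Phi)^-1 P^-1   or
     N (Phi^T Phi)^-1 - Sigma^-1 = - N (Phi^T Phi)^-1 Delta Sigma^-1.
   The upper bounds of the E_i come from |A^-1|_F <= sqrt n / lambda_n(A) for
   positive definite A and |Delta|_F <= sqrt n max |lambda_i(Delta)|. *)
Require Import Defs.
From HB Require Import structures.
From mathcomp Require Import all_boot all_order all_algebra.
From mathcomp Require Import ring lra complex.
From mathcomp Require Import all_classical all_reals all_analysis.

Set Implicit Arguments.
Unset Strict Implicit.
Unset Printing Implicit Defensive.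

Import Order.TTheory GRing.Theory Num.Theory.
Import numFieldNormedType.Exports.

Local Open Scope classical_set_scope.
Local Open Scope ring_scope.

(** * Frobenius norm: Cauchy-Schwarz, triangle inequality and submultiplicativity *)

Section FrobeniusNorm.
Variable R : realType.

(** With a, b, c the three sums, [c * (a * c - b ^+ 2)] is the sum of the squares of
    [c * f i - b * g i], which settles c > 0. If c = 0, every [g i] vanishes and so does b. *)
Lemma cauchy_schwarz_sum (I : finType) (f g : I -> R) :
  (\sum_i f i * g i) ^+ 2 <= (\sum_i f i ^+ 2) * (\sum_i g i ^+ 2).
Proof.
set a := \sum_i f i ^+ 2; set b := \sum_i f i * g i; set c := \sum_i g i ^+ 2.
have c_ge0 : 0 <= c by apply: sumr_ge0 => i _; exact: sqr_ge0.
have [c0|c_neq0] := eqVneq c 0.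
  suff -> : b = 0 by rewrite c0 mulr0 expr0n.
  apply: big1 => i _.
  have /psumr_eq0P /(_ i isT)/eqP : c = 0 by [].
  by rewrite sqrf_eq0 => /(_ (fun j _ => sqr_ge0 _))/eqP ->; rewrite mulr0.
have c_gt0 : 0 < c by rewrite lt0r c_neq0.
rewrite -subr_ge0 -(pmulr_rge0 _ c_gt0).
have -> : c * (a * c - b ^+ 2) = \sum_i (c * f i - b * g i) ^+ 2.
  under eq_bigr => i _.
    have -> : (c * f i - b * g i) ^+ 2
            = c ^+ 2 * f i ^+ 2 - 2 * b * c * (f i * g i) + b ^+ 2 * g i ^+ 2.
      by ring.
    over.
  by rewrite !big_split /= sumrN -!mulr_sumr -/a -/b -/c; ring.
by apply: sumr_ge0 => i _; exact: sqr_ge0.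
Qed.

Lemma normF_ge0 m n (A : 'M[R]_(m, n)) : 0 <= normF A.
Proof. exact: sqrtr_ge0. Qed.

Lemma normF_sqr m n (A : 'M[R]_(m, n)) :
  normF A ^+ 2 = \sum_i \sum_j A i j ^+ 2.
Proof.
rewrite sqr_sqrtr //; apply: sumr_ge0 => i _; apply: sumr_ge0 => j _.
exact: sqr_ge0.
Qed.

Lemma normF_sqr_trace m n (A : 'M[R]_(m, n)) :
  normF A ^+ 2 = \tr (A *m A^T).
Proof.
rewrite normF_sqr /mxtrace; apply: eq_bigr => i _; rewrite mxE.
by apply: eq_bigr => j _; rewrite mxE expr2.
Qed.

Lemma normF_eq0 m n (A : 'M[R]_(m, n)) : (normF A == 0) = (A == 0).
Proof.
apply/eqP/eqP => [|->]; last first.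
  rewrite /normF big1 ?sqrtr0 // => i _.
  by apply: big1 => j _; rewrite mxE expr0n.
move=> /(congr1 (fun t => t ^+ 2)); rewrite normF_sqr expr0n pair_bigA /= => A0.
apply/matrixP => i j; rewrite [RHS]mxE; apply/eqP; rewrite -sqrf_eq0; apply/eqP.
by apply: (psumr_eq0P _ A0 (i := (i, j))) => // k _; exact: sqr_ge0.
Qed.

Lemma norm2E m (x : 'cV[R]_m) : norm2 x = normF x.
Proof. by congr Num.sqrt; apply: eq_bigr => i _; rewrite big_ord1. Qed.

Lemma normF11 (A : 'M[R]_1) : normF A = `|A 0 0|.
Proof. by rewrite /normF !big_ord1 sqrtr_sqr. Qed.

Lemma normF_tr m n (A : 'M[R]_(m, n)) : normF A^T = normF A.
Proof.
congr Num.sqrt; rewrite exchange_big.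
by apply: eq_bigr => i _; apply: eq_bigr => j _; rewrite mxE.
Qed.

Lemma normFZ m n (a : R) (A : 'M[R]_(m, n)) : normF (a *: A) = `|a| * normF A.
Proof.
rewrite -sqrtr_sqr -sqrtrM ?sqr_ge0 //; congr Num.sqrt; rewrite mulr_sumr.
apply: eq_bigr => i _; rewrite mulr_sumr.
by apply: eq_bigr => j _; rewrite mxE exprMn.
Qed.

Lemma normFN m n (A : 'M[R]_(m, n)) : normF (- A) = normF A.
Proof. by rewrite -scaleN1r normFZ normrN1 mul1r. Qed.

(** Cauchy-Schwarz over index pairs: the trace is the entrywise inner product of [A] and [B^T]. *)
Lemma trace_mul_le m n (A : 'M[R]_(m, n)) (B : 'M[R]_(n, m)) :
  `|\tr (A *m B)| <= normF A * normF B.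
Proof.
rewrite -sqrtr_sqr -(normF_tr B) /normF -sqrtrM ?ler_wsqrtr //; last first.
  by rewrite -normF_sqr sqr_ge0.
rewrite !pair_bigA /=; apply: le_trans (cauchy_schwarz_sum _ _).
rewrite -(pair_bigA _ (fun i j => A i j * B^T i j)) /= /mxtrace.
rewrite le_eqVlt; apply/orP; left; apply/eqP; congr (_ ^+ 2).
by apply: eq_bigr => i _; rewrite mxE; apply: eq_bigr => j _; rewrite mxE.
Qed.

(** Squaring turns the claim into a trace expansion whose two cross terms coincide, and
    [trace_mul_le] bounds them. *)
Lemma normFD m n (A B : 'M[R]_(m, n)) : normF (A + B) <= normF A + normF B.
Proof.
rewrite -(@ler_pXn2r _ 2) ?nnegrE ?addr_ge0 ?normF_ge0 //.
rewrite [leLHS]normF_sqr_trace linearD /= mulmxDl !mulmxDr !linearD /=.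
rewrite -!normF_sqr_trace.
have trE : \tr (B *m A^T) = \tr (A *m B^T).
  by rewrite -mxtrace_tr trmx_mul trmxK.
have := trace_mul_le A B^T; rewrite normF_tr => /(le_trans (ler_norm _)) trle.
rewrite trE; nra.
Qed.

(** Each entry of the product pairs a row of [A] with a column of [B]; Cauchy-Schwarz is applied
    entry by entry and summed. *)
Lemma normFM m n k (A : 'M[R]_(m, n)) (B : 'M[R]_(n, k)) :
  normF (A *m B) <= normF A * normF B.
Proof.
rewrite -(@ler_pXn2r _ 2) ?nnegrE ?mulr_ge0 ?normF_ge0 //.
rewrite exprMn -(normF_tr B) !normF_sqr mulr_suml; apply: ler_sum => i _.
rewrite mulr_sumr; apply: ler_sum => j _; rewrite mxE.
apply: le_trans (cauchy_schwarz_sum _ _) _; rewrite ler_wpM2l //.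
  by apply: sumr_ge0 => l _; exact: sqr_ge0.
by apply: ler_sum => l _; rewrite mxE.
Qed.

Lemma bform_le m n (x : 'cV[R]_m) (A : 'M[R]_(m, n)) (y : 'cV[R]_n) :
  `|bform x A y| <= normF x * normF A * normF y.
Proof.
rewrite /bform -normF11; apply: le_trans (normFM _ _) _.
rewrite ler_wpM2r ?normF_ge0 //; apply: le_trans (normFM _ _) _.
by rewrite normF_tr.
Qed.

End FrobeniusNorm.

(** * Positive definite matrices, Gram matrices, and the trace bound by rank *)

Section PositiveDefinite.
Variable R : realType.

Lemma posdef_unit n (A : 'M[R]_n) : posdef A -> A \in unitmx.
Proof.
case=> A_sym A_pos; rewrite unitmxE unitfE.
apply/negP => /det0P[v v_neq0 vA].
have := A_pos v^T; rewrite /bform trmxK vA mul0mx mxE ltxx trmx_eq0 => h.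
by have := h v_neq0.
Qed.

(** The quadratic form at x is the squared norm of [A *m x], which vanishes only at x = 0 because
    full column rank makes [A] injective. *)
Lemma posdef_gram m n (A : 'M[R]_(m, n)) : \rank A = n -> posdef (gram A).
Proof.
move=> A_rank; split; first by rewrite /gram trmx_mul trmxK.
move=> x x_neq0; rewrite /bform /gram mulmxA -mulmxA -trmx_mul.
have -> : ((A *m x)^T *m (A *m x)) 0 0 = normF (A *m x) ^+ 2.
  by rewrite -normF_tr normF_sqr_trace trmxK /mxtrace big_ord1.
rewrite exprn_gt0 // lt0r normF_ge0 andbT normF_eq0; apply/eqP => Ax0.
case/negP: x_neq0; rewrite -trmx_eq0.
have A_free : row_free A^T by rewrite /row_free mxrank_tr A_rank.
apply/eqP/(row_free_inj A_free); rewrite mul0mx -trmx_mul Ax0.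
exact: trmx0.
Qed.

Lemma posdef_inv n (A : 'M[R]_n) : posdef A -> posdef (invmx A).
Proof.
move=> A_pd; have [A_sym A_pos] := A_pd; have A_unit := posdef_unit A_pd.
have Ai_sym : (invmx A)^T = invmx A by rewrite trmx_inv A_sym.
split=> // x x_neq0.
have -> : bform x (invmx A) x = bform (invmx A *m x) A (invmx A *m x).
  by rewrite /bform trmx_mul Ai_sym !mulmxA mulmxKV.
apply: A_pos; apply: contra_neq x_neq0 => Aix0.
by rewrite -[x](mulKVmx A_unit) Aix0 mulmx0.
Qed.

Lemma posdefD n (A B : 'M[R]_n) : posdef A -> posdef B -> posdef (A + B).
Proof.
move=> [A_sym A_pos] [B_sym B_pos]; split; first by rewrite linearD /= A_sym B_sym.
move=> x x_neq0; rewrite /bform mulmxDr mulmxDl mxE.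
by apply: addr_gt0; [exact: A_pos | exact: B_pos].
Qed.

Lemma posdefZ n (a : R) (A : 'M[R]_n) : 0 < a -> posdef A -> posdef (a *: A).
Proof.
move=> a_gt0 [A_sym A_pos]; split; first by rewrite linearZ /= A_sym.
move=> x x_neq0; rewrite /bform -scalemxAr -scalemxAl mxE.
by apply: mulr_gt0 => //; exact: A_pos.
Qed.

Lemma posdef_Smx m n sigma (A : 'M[R]_(m, n)) (P : 'M[R]_n) :
  0 < sigma -> \rank A = n -> posdef P -> posdef (Smx sigma A P).
Proof.
move=> sigma_gt0 A_rank P_pd; apply: posdefD => //.
by apply: posdefZ; [exact: exprn_gt0 | exact/posdef_inv/posdef_gram].
Qed.

(* Inserting the orthogonal projection onto the column space of [A], whose
   Frobenius norm is the square root of the rank, before Cauchy-Schwarz. *)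
Lemma trace_le_rank n (A : 'M[R]_n) :
  `|\tr A| <= Num.sqrt (\rank A)%:R * normF A.
Proof.
pose C := col_base A; pose G := invmx (gram C); pose H := C *m G *m C^T.
have C_pd : posdef (gram C).
  by apply: posdef_gram; apply/eqP; exact: col_base_full.
have C_unit := posdef_unit C_pd; have [C_sym _] := C_pd.
have HC : H *m C = C by rewrite /H -!mulmxA mulVmx // mulmx1.
have HA : H *m A = A.
  by rewrite -[A in LHS]mulmx_base mulmxA HC mulmx_base.
have H_sym : H^T = H.
  by rewrite /H trmx_mul trmxK (trmx_mul C) /G trmx_inv C_sym mulmxA.
have H_norm : normF H = Num.sqrt (\rank A)%:R.
  rewrite -[LHS]ger0_norm ?normF_ge0 // -sqrtr_sqr normF_sqr_trace H_sym.
  have -> : H *m H = H by rewrite {2}/H 2!(mulmxA H) HC.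
  by rewrite /H mxtrace_mulC mulmxA -/(gram C) mulmxV // mxtrace1.
by rewrite -[A in leLHS]HA -H_norm trace_mul_le.
Qed.

End PositiveDefinite.

(** * Diagonalization of real symmetric matrices over the complex numbers *)

Section Spectrum.
Variable R : realType.

Let C : numClosedFieldType := complex R.
Let f : {rmorphism R -> C} := real_complex R.

(** The scalar matrix X commutes with constant matrices, so [char_poly_mx] is itself conjugated and
    its determinant is unchanged. *)
Lemma char_poly_conj (F : fieldType) n (U A : 'M[F]_n) :
  U \in unitmx -> char_poly (invmx U *m A *m U) = char_poly A.
Proof.
move=> U_unit; rewrite /char_poly.
pose V := map_mx (@polyC F) U; pose Vi := map_mx (@polyC F) (invmx U).
have ViV : Vi *m V = 1%:M by rewrite -map_mxM mulVmx // map_mx1.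
have -> : char_poly_mx (invmx U *m A *m U) = Vi *m char_poly_mx A *m V.
  rewrite /char_poly_mx !map_mxM mulmxBr mulmxBl; congr (_ - _).
  by rewrite scalar_mxC -mulmxA ViV mulmx1.
rewrite !det_mulmx mulrAC -det_mulmx ViV det1 mul1r //.
Qed.

Lemma symmetric_diag n (A : 'M[R]_n) : A^T = A ->
  exists (U : 'M[C]_n) (d : 'rV[R]_n), U \in unitmx /\
    map_mx f A = invmx U *m diag_mx (map_mx f d) *m U.
Proof.
move=> A_sym; set B := map_mx f A.
have B_herm : B \is hermsymmx.
  apply: realsym_hermsym.
    by apply/is_hermitianmxP; rewrite expr0 scale1r map_mx_id // map_trmx A_sym.
  by apply/mxOverP => i j; rewrite mxE complex_real.
have /mxOverP d_real := hermitian_spectral_diag_real B_herm.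
have /orthomx_spectralP B_eq := hermitian_normalmx B_herm.
exists (spectralmx B), (map_mx (@complex.Re R) (spectral_diag B)).
split; first exact: spectral_unit.
rewrite {1}B_eq; congr (_ *m diag_mx _ *m _).
by apply/rowP => i; rewrite !mxE; apply/esym/RRe_real/d_real.
Qed.

(** By symmetry the squared norms are the traces of the squares of [A] and of its inverse. All
    identities are checked on the diagonal form over [C] and pulled back along the injective [f]. *)
Lemma symmetric_spectrum n (A : 'M[R]_n) : A^T = A ->
  exists d : 'I_n -> R,
  [/\ char_poly A = \prod_i ('X - (d i)%:P),
      normF A ^+ 2 = \sum_i d i ^+ 2
    & A \in unitmx -> normF (invmx A) ^+ 2 = \sum_i (d i)^-1 ^+ 2].
Proof.
move=> A_sym; have [U [d [U_unit A_eq]]] := symmetric_diag A_sym.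
set D := diag_mx (map_mx f d) in A_eq.
have tr_conj (B : 'M[C]_n) : \tr (invmx U *m B *m U) = \tr B.
  by rewrite mxtrace_mulC mulKVmx.
have conjM (B1 B2 : 'M[C]_n) : invmx U *m B1 *m U *m (invmx U *m B2 *m U)
    = invmx U *m (B1 *m B2) *m U by rewrite !mulmxA mulmxK.
have tr_diag (e : 'rV[R]_n) : \tr (diag_mx (map_mx f e) *m diag_mx (map_mx f e))
    = f (\sum_i e 0 i ^+ 2).
  rewrite mulmx_diag mxtrace_diag rmorph_sum; apply: eq_bigr => i _.
  by rewrite !mxE -rmorphM -expr2.
have f_inj : injective f := @complexI R.
exists (fun i => d 0 i); split.
- apply: (map_poly_inj f); rewrite map_char_poly A_eq char_poly_conj //.
  rewrite char_poly_trig ?diag_mx_is_trig // map_prod_XsubC.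
  by apply: eq_bigr => i _; rewrite !mxE eqxx.
- apply: f_inj; rewrite normF_sqr_trace A_sym -trace_map_mx map_mxM A_eq.
  by rewrite conjM tr_conj tr_diag.
- move=> A_unit.
  (* The determinant of [A] is that of the diagonal form, so a zero entry would make [A]
     singular. *)
  have d_neq0 i : d 0 i != 0.
    apply: contraTneq A_unit => di0; rewrite unitmxE unitfE negbK.
    rewrite -(fmorph_eq0 f) -det_map_mx A_eq !det_mulmx det_diag.
    by rewrite (bigD1 i) //= mxE di0 rmorph0 mul0r mulr0 mul0r.
  pose e : 'rV[R]_n := \row_i (d 0 i)^-1.
  have DE : D *m diag_mx (map_mx f e) = 1%:M.
    rewrite mulmx_diag -diag_const_mx; congr diag_mx; apply/rowP => i.
    by rewrite !mxE -rmorphM divff ?rmorph1.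
  have Ai_eq : map_mx f (invmx A) = invmx U *m diag_mx (map_mx f e) *m U.
    have B_unit : map_mx f A \in unitmx by rewrite map_unitmx.
    rewrite map_invmx -[RHS](mulKmx B_unit) {3}A_eq conjM DE mulmx1.
    by rewrite mulVmx // mulmx1.
  have -> : \sum_i (d 0 i)^-1 ^+ 2 = \sum_i e 0 i ^+ 2.
    by apply: eq_bigr => i _; rewrite mxE.
  apply: f_inj; rewrite normF_sqr_trace trmx_inv A_sym -trace_map_mx map_mxM Ai_eq.
  by rewrite conjM tr_conj tr_diag.
Qed.

End Spectrum.

(** * The ordered eigenvalue list and the norm bounds it gives *)

Section Eigenvalues.
Variable R : realType.

(** Sorting the spectrum [d] shows that the set behind [xget] is inhabited. Unique factorization
    into linear factors then makes the chosen list a permutation of [d], so sums over [d] become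
    sums over the list. *)
Lemma eigenvalues_spec n (A : 'M[R]_n) (A_sym : A^T = A)
    (s := eigenvalues A) :
  [/\ sorted >=%R s, size s = n, char_poly A = \prod_(a <- s) ('X - a%:P),
      normF A ^+ 2 = \sum_(a <- s) a ^+ 2
    & A \in unitmx -> normF (invmx A) ^+ 2 = \sum_(a <- s) a^-1 ^+ 2].
Proof.
have [d [charE normE invE]] := symmetric_spectrum A_sym.
have [s_sorted s_char] : sorted >=%R s /\ char_poly A = \prod_(a <- s) ('X - a%:P).
  have ex_s : [set t | sorted >=%R t /\ char_poly A = \prod_(a <- t) ('X - a%:P)]
      (sort >=%R (codom d)).
    split; first exact/sort_sorted/ge_total.
    by rewrite (perm_big _ (permEl (perm_sort _ _))) big_map big_enum.
  exact: xgetPex (ex_intro _ _ ex_s).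
have s_perm : perm_eq s (codom d).
  by apply: prod_XsubC_eq; rewrite -s_char charE big_map big_enum.
have sum_s (g : R -> R) : \sum_(a <- s) g a = \sum_i g (d i).
  by rewrite (perm_big _ s_perm) big_map big_enum.
split=> //; last 2 first.
- by rewrite sum_s.
- by rewrite sum_s.
- by rewrite (perm_size s_perm) size_codom card_ord.
Qed.

(** On an eigenvector v the quadratic form equals a times the squared norm of v. *)
Lemma posdef_eigenvalues_gt0 n (A : 'M[R]_n) (a : R) :
  posdef A -> a \in eigenvalues A -> 0 < a.
Proof.
case=> A_sym A_pos a_in; have [_ _ charE _ _] := eigenvalues_spec A_sym.
have : root (char_poly A) a by rewrite charE root_prod_XsubC.
rewrite -eigenvalue_root_char => /eigenvalueP[v vA v_neq0].
have := A_pos v^T; rewrite trmx_eq0 => /(_ v_neq0).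
rewrite /bform trmxK vA -scalemxAl mxE.
have -> : (v *m v^T) 0 0 = normF v ^+ 2.
  by rewrite normF_sqr_trace /mxtrace big_ord1.
by rewrite pmulr_lgt0 // exprn_gt0 // lt0r normF_ge0 normF_eq0 v_neq0.
Qed.

Lemma sorted_ge_nth (s : seq R) (i j : nat) : sorted >=%R s ->
  (i <= j)%N -> (j < size s)%N -> s`_j <= s`_i.
Proof.
move=> s_sorted le_ij lt_j.
apply: (sorted_leq_nth ge_trans ge_refl 0 s_sorted) => //.
by rewrite inE (leq_ltn_trans le_ij).
Qed.

Lemma posdef_lambda_gt0 n (A : 'M[R]_n) (k : nat) :
  posdef A -> (0 < k <= n)%N -> 0 < lambda A k.
Proof.
move=> A_pd k_bounds; have [_ size_s _ _ _] := eigenvalues_spec A_pd.1.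
apply: (posdef_eigenvalues_gt0 A_pd); apply: mem_nth.
by rewrite size_s; case: k k_bounds.
Qed.

Lemma cond_div_lambda n (A : 'M[R]_n) : posdef A -> (0 < n)%N ->
  cond A / lambda A 1 = (lambda A n)^-1.
Proof.
move=> A_pd n_gt0; rewrite /cond mulrAC divff ?mul1r //.
by rewrite gt_eqF // posdef_lambda_gt0.
Qed.

(** The right side is sqrt n over the smallest eigenvalue, written in the shape the final bounds
    use. The squared norm is a sum of n inverse squares, each largest at that eigenvalue. *)
Lemma normF_invmx_le n (A : 'M[R]_n) : posdef A -> (0 < n)%N ->
  normF (invmx A) <= Num.sqrt n%:R * (cond A / lambda A 1).
Proof.
move=> A_pd n_gt0; rewrite cond_div_lambda //.
have [s_sorted size_s _ _ /(_ (posdef_unit A_pd)) invE] := eigenvalues_spec A_pd.1.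
have l_gt0 : 0 < lambda A n by rewrite posdef_lambda_gt0 // n_gt0 leqnn.
rewrite -(@ler_pXn2r _ 2) ?nnegrE ?normF_ge0 ?mulr_ge0 ?sqrtr_ge0 //;
  last by rewrite invr_ge0 ltW.
rewrite invE exprMn sqr_sqrtr ?ler0n // (big_nth 0) big_mkord size_s.
apply: le_trans (_ : \sum_(i < n) (lambda A n)^-1 ^+ 2 <= _); last first.
  by rewrite sumr_const card_ord mulr_natl.
apply: ler_sum => i _.
have si_gt0 : 0 < (eigenvalues A)`_i.
  by apply: (posdef_eigenvalues_gt0 A_pd); rewrite mem_nth ?size_s.
rewrite ler_pXn2r ?nnegrE ?invr_ge0 ?(ltW si_gt0) ?(ltW l_gt0) //.
(* Lists are indexed from 0, so [lambda A n] is the last entry, at position n - 1. *)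
rewrite lef_pV2 ?posrE // /lambda; apply: sorted_ge_nth => //.
  by rewrite -ltnS prednK.
by rewrite size_s prednK.
Qed.

Lemma normF_le_lambda_abs n (A : 'M[R]_n) : A^T = A -> (0 < n)%N ->
  normF A <= Num.sqrt n%:R * lambda_abs A 1.
Proof.
move=> A_sym n_gt0; have [_ size_s _ normE _] := eigenvalues_spec A_sym.
set s := [seq `|a| | a <- eigenvalues A].
have size_t : size (sort >=%R s) = n by rewrite size_sort size_map.
have le_l1 a : a \in eigenvalues A -> `|a| <= lambda_abs A 1.
  move=> a_in; have a_in_t : `|a| \in sort >=%R s.
    by rewrite mem_sort; apply: map_f.
  rewrite -(nth_index 0 a_in_t); apply: sorted_ge_nth => //.
    exact/sort_sorted/ge_total.
  by rewrite index_mem.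
have l1_ge0 : 0 <= lambda_abs A 1.
  have : (eigenvalues A)`_0 \in eigenvalues A by rewrite mem_nth ?size_s.
  by move/le_l1; apply: le_trans.
rewrite -(@ler_pXn2r _ 2) ?nnegrE ?normF_ge0 ?mulr_ge0 ?sqrtr_ge0 //.
rewrite normE exprMn sqr_sqrtr ?ler0n // (big_nth 0) big_mkord size_s.
apply: le_trans (_ : \sum_(i < n) lambda_abs A 1 ^+ 2 <= _); last first.
  by rewrite sumr_const card_ord mulr_natl.
apply: ler_sum => i _; rewrite -real_normK ?num_real // ler_pXn2r ?nnegrE //.
by apply: le_l1; rewrite mem_nth ?size_s.
Qed.

(** A zero modulus makes 0 a root of the characteristic polynomial, whose value there is the
    determinant up to sign. *)
Lemma lambda_abs_neq0 n (A : 'M[R]_n) : A^T = A -> (0 < n)%N ->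
  \det A != 0 -> lambda_abs A n != 0.
Proof.
move=> A_sym n_gt0; have [_ size_s charE _ _] := eigenvalues_spec A_sym.
apply: contra_neq => ln0.
have : 0 \in [seq `|a| | a <- eigenvalues A].
  rewrite -(mem_sort >=%R) -ln0; apply: mem_nth.
  by rewrite size_sort size_map size_s prednK.
case/mapP => a a_in /esym/eqP; rewrite normr_eq0 => /eqP a0.
have : root (char_poly A) 0 by rewrite charE root_prod_XsubC -a0.
rewrite rootE horner_coef0 char_poly_det mulf_eq0 signr_eq0 /=.
by move/eqP.
Qed.

(** The product on the right cancels to the largest modulus. For singular [A] the factor
    [lambda_abs A n] is 0 and the inequality would fail unless [A] = 0, whence the determinant
    condition. *)
Lemma normF_le_cond_abs n (A : 'M[R]_n) : A^T = A -> (0 < n)%N ->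
  \det A != 0 -> normF A <= Num.sqrt n%:R * (lambda_abs A n * cond_abs A).
Proof.
move=> A_sym n_gt0 detA.
have -> : lambda_abs A n * cond_abs A = lambda_abs A 1.
  by rewrite /cond_abs mulrCA divff ?mulr1 ?lambda_abs_neq0.
exact: normF_le_lambda_abs.
Qed.

End Eigenvalues.

(** * Woodbury identity and closed form of the normalized SURE cost *)

Section CostFunction.
Variables (R : realType) (N n : nat) (sigma : R) (Phi : 'M[R]_(N, n)).
Variables (P : 'M[R]_n).
Hypothesis sigma_gt0 : 0 < sigma.
Hypothesis Phi_rank : \rank Phi = n.
Hypothesis P_pd : posdef P.
Let G := invmx (gram Phi).
Let Si := invmx (Smx sigma Phi P).
Let H := Phi *m G *m Phi^T.

Let A_pd : posdef (gram Phi) := posdef_gram Phi_rank.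
Let S_pd : posdef (Smx sigma Phi P) := posdef_Smx sigma_gt0 Phi_rank P_pd.
Let G_sym : G^T = G := (posdef_inv A_pd).1.
Let Si_sym : Si^T = Si := (posdef_inv S_pd).1.

(** Here [H] is the orthogonal projection onto the column space of [Phi]. The claimed expression is
    multiplied by Q and seen to give sigma^2 times the identity. *)
Lemma invmx_Qmx :
  Qmx sigma Phi P \in unitmx /\
  sigma ^+ 2 *: invmx (Qmx sigma Phi P)
  = 1%:M - H + sigma ^+ 2 *: (Phi *m (G *m Si *m G) *m Phi^T).
Proof.
set s2 := sigma ^+ 2; set Q := Qmx sigma Phi P; set M := G *m Si *m G.
have s2_neq0 : s2 != 0 by rewrite expf_neq0 // gt_eqF.
have QE m (Z : 'M[R]_(N, m)) : Q *m Z = Phi *m (P *m (Phi^T *m Z)) + s2 *: Z.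
  by rewrite /Q /Qmx mulmxDl mul_scalar_mx !mulmxA.
have PhiH : Phi^T *m H = Phi^T.
  by rewrite /H !mulmxA mulmxV ?mul1mx // posdef_unit.
have AM : gram Phi *m M = Si *m G.
  by rewrite /M !mulmxA mulmxV ?mul1mx // posdef_unit.
(* With A = [gram Phi], A M = S^-1 G turns the left side into (P + sigma^2 G) S^-1 G, which is S
   S^-1 G. *)
have SM : P *m (gram Phi *m M) + s2 *: M = G.
  rewrite AM /M -!mulmxA scalemxAl -mulmxDl mulmxA -/(Smx sigma Phi P).
  by rewrite mulmxV ?mul1mx // posdef_unit.
have QM : Q *m (Phi *m M *m Phi^T) = H.
  have -> : H = Phi *m (P *m (gram Phi *m M) + s2 *: M) *m Phi^T by rewrite SM.
  by rewrite QE mulmxDr mulmxDl -scalemxAr -scalemxAl /gram !mulmxA.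
(* Q acts on the range of 1 - H as sigma^2, because [Phi^T] kills it; the last summand contributes
   the missing sigma^2 H. *)
have QX : Q *m (1%:M - H + s2 *: (Phi *m M *m Phi^T)) = s2%:M.
  rewrite mulmxDr -scalemxAr QM QE mulmxBr PhiH mulmx1 subrr !mulmx0 add0r.
  by rewrite scalerBr subrK scalemx1.
have Q_unit : Q \in unitmx.
  have : Q *m (s2^-1 *: (1%:M - H + s2 *: (Phi *m M *m Phi^T))) = 1%:M.
    by rewrite -scalemxAr QX scale_scalar_mx mulVf.
  by move/mulmx1_unit => [].
by split; rewrite // -[RHS](mulKmx Q_unit) QX mul_mx_scalar.
Qed.

(** The residual is sigma^2 Q^-1 Y, which splits orthogonally into (1 - H) Y and a vector in the
    column space of [Phi]. The normalization removes the squared norm of the first part and the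
    constant 2 n sigma^2 from the trace. *)
Lemma F_Sy_barE (Y : 'cV[R]_N) (theta := G *m Phi^T *m Y) :
  F_Sy_bar sigma Phi Y P
  = sigma ^+ 4 * N%:R * bform theta (Si *m G *m Si) theta
    - 2 * sigma ^+ 4 * N%:R * \tr (G *m Si).
Proof.
set s2 := sigma ^+ 2; set Q := Qmx sigma Phi P.
have [Q_unit Q_inv] : Q \in unitmx /\ _ := invmx_Qmx.
rewrite -/s2 -/Q in Q_inv.
set B := G *m Si *m G in Q_inv.
have PE : Phi *m P *m Phi^T *m invmx Q = 1%:M - s2 *: invmx Q.
  rewrite -{1}(mulmxV Q_unit) -mul_scalar_mx -mulmxBl.
  by rewrite /Q /Qmx addrK.
have trE : \tr (Phi *m P *m Phi^T *m invmx Q) = n%:R - s2 * \tr (G *m Si).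
  rewrite PE Q_inv opprD opprB addrA addrCA subrr addr0.
  rewrite linearB linearZ /= /H mxtrace_mulC mulmxA mulmxV ?posdef_unit //.
  rewrite mxtrace1 (mxtrace_mulC _ Phi^T) !mulmxA mulmxV ?posdef_unit //.
  by rewrite mul1mx mxtrace_mulC.
have resE : Y - Phi *m theta_R sigma Phi P Y
    = (1%:M - H) *m Y + s2 *: (Phi *m (G *m (Si *m theta))).
  rewrite /theta_R -/Q !mulmxA -{1}[Y]mul1mx -mulmxBl PE opprB addrC subrK.
  by rewrite Q_inv mulmxDl -scalemxAl /B /theta !mulmxA.
have A_unit := posdef_unit A_pd.
have H_sym : H^T = H by rewrite /H !trmx_mul trmxK G_sym mulmxA.
pose C := 1%:M - H.
have C_sym : C^T = C by rewrite linearB /= trmx1 H_sym.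
have CPhi : C *m Phi = 0.
  by rewrite mulmxBl mul1mx /H -!mulmxA mulVmx // mulmx1 subrr.
have CC : C *m C = C.
  by rewrite {2}/C /H mulmxBr mulmx1 !mulmxA CPhi !mul0mx subr0.
(* This is the squared norm of the column-space part; the Gram matrix cancels one of the two factors
   G. *)
have zE (t : 'cV_n) : (G *m (Si *m t))^T *m gram Phi *m (G *m (Si *m t))
    = t^T *m (Si *m G *m Si) *m t.
  rewrite !trmx_mul G_sym Si_sym -!mulmxA.
  by rewrite (mulmxA Phi^T) -/(gram Phi) (mulKVmx A_unit).
have normE : norm2 (Y - Phi *m theta_R sigma Phi P Y) ^+ 2
    = bform Y 1%:M Y - bform Y H Y + s2 ^+ 2 * bform theta (Si *m G *m Si) theta.
  rewrite norm2E -normF_tr normF_sqr_trace trmxK /mxtrace big_ord1 resE.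
  set z := G *m (Si *m theta); set a := C *m Y.
  have az : (Phi *m z)^T *m a = 0.
    by rewrite /a trmx_mul -{1}C_sym -mulmxA (mulmxA Phi^T) -trmx_mul
      CPhi trmx0 mul0mx mulmx0.
  have za : a^T *m (Phi *m z) = 0.
    by rewrite -[LHS]trmxK trmx_mul trmxK az trmx0.
  have aa : a^T *m a = Y^T *m C *m Y.
    by rewrite -[in RHS]CC /a trmx_mul C_sym !mulmxA.
  have zz : (Phi *m z)^T *m (Phi *m z) = theta^T *m (Si *m G *m Si) *m theta.
    by rewrite -zE -/z /gram (mulmxA z^T) -trmx_mul mulmxA.
  have resT : (a + s2 *: (Phi *m z))^T = a^T + s2 *: (Phi *m z)^T.
    by rewrite linearD linearZ.
  rewrite resT mulmxDl !mulmxDr -!scalemxAl -!scalemxAr.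
  rewrite az za aa zz /C !scaler0 addr0 add0r scalerA /bform mulmxBr mulmxBl.
  by rewrite !mxE expr2.
rewrite /F_Sy_bar /F_Sy normE -/Q trE -/H.
by rewrite /s2; ring.
Qed.

End CostFunction.

(** * Difference between the normalized cost and its limit function *)

Section ErrorBound.
Variable R : realType.

Lemma invmxB n (A B : 'M[R]_n) : A \in unitmx -> B \in unitmx ->
  invmx A - invmx B = invmx A *m (B - A) *m invmx B.
Proof.
move=> A_unit B_unit.
by rewrite mulmxBr mulmxBl mulmxK // mulVmx // mul1mx.
Qed.

Lemma bformDl m n (x y : 'cV[R]_m) (A : 'M[R]_(m, n)) (z : 'cV[R]_n) :
  bform (x + y) A z = bform x A z + bform y A z.
Proof. by rewrite /bform linearD /= !mulmxDl mxE. Qed.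

Lemma bformDr m n (x : 'cV[R]_m) (A : 'M[R]_(m, n)) (y z : 'cV[R]_n) :
  bform x A (y + z) = bform x A y + bform x A z.
Proof. by rewrite /bform mulmxDr mxE. Qed.

Lemma bformZB m n (x : 'cV[R]_m) (a : R) (A B : 'M[R]_(m, n)) (y : 'cV[R]_n) :
  bform x (a *: A - B) y = a * bform x A y - bform x B y.
Proof. by rewrite /bform mulmxBr mulmxBl -scalemxAr -scalemxAl !mxE. Qed.

Lemma bform_sym n (A : 'M[R]_n) (x y : 'cV[R]_n) : A^T = A ->
  bform x A y = bform y A x.
Proof.
move=> A_sym; rewrite /bform -[in RHS]A_sym.
have -> : y^T *m A^T *m x = (x^T *m A *m y)^T by rewrite !trmx_mul trmxK mulmxA.
by rewrite [RHS]mxE.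
Qed.

Lemma normFM3 m1 m2 m3 m4 (A : 'M[R]_(m1, m2)) (B : 'M[R]_(m2, m3))
    (C : 'M[R]_(m3, m4)) (a1 a2 a3 : R) :
  normF A <= a1 -> normF B <= a2 -> normF C <= a3 ->
  normF (A *m B *m C) <= a1 * a2 * a3.
Proof.
move=> A_le B_le C_le; apply: le_trans (normFM _ _) _.
rewrite ler_pM ?normF_ge0 //; apply: le_trans (normFM _ _) _.
by rewrite ler_pM ?normF_ge0.
Qed.

Lemma abs_bform_le m1 m2 (x : 'cV[R]_m1) (A : 'M[R]_(m1, m2)) (y : 'cV[R]_m2)
    (a1 a2 a3 : R) :
  normF x <= a1 -> normF A <= a2 -> normF y <= a3 ->
  `|bform x A y| <= a1 * a2 * a3.
Proof.
move=> x_le A_le y_le; apply: le_trans (bform_le _ _ _) _.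
by rewrite ler_pM ?mulr_ge0 ?normF_ge0 // ler_pM ?normF_ge0.
Qed.

Variables (N n : nat) (sigma : R) (theta0 : 'cV[R]_n) (Phi : 'M[R]_(N, n)).
Variables (V : 'cV[R]_N) (Sigma P : 'M[R]_n).
Hypothesis N_gt0 : (0 < N)%N.
Hypothesis sigma_gt0 : 0 < sigma.
Hypothesis Phi_rank : \rank Phi = n.
Hypothesis P_pd : posdef P.
Hypothesis Sigma_pd : posdef Sigma.
Let G := invmx (gram Phi).
Let Si := invmx (Smx sigma Phi P).
Let Pi := invmx P.
Let Ci := invmx Sigma.
Let v := normF (Phi^T *m V).
Let th := normF theta0.
Let b := normF G.
Let s := normF Si.
Let c := normF Ci.
Let p := normF Pi.
Let dl := normF (Delta Phi Sigma).

Let A_unit : gram Phi \in unitmx := posdef_unit (posdef_gram Phi_rank).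
Let S_pd : posdef (Smx sigma Phi P) := posdef_Smx sigma_gt0 Phi_rank P_pd.

(** The difference of inverses is S^-1 (P - S) P^-1, and P - S is - sigma^2 G. *)
Lemma normF_invS_sub : normF (Si - Pi) <= sigma ^+ 2 * s * b * p.
Proof.
rewrite /Si /Pi invmxB ?posdef_unit // -/Si -/Pi.
have -> : P - Smx sigma Phi P = - (sigma ^+ 2 *: G).
  by rewrite /Smx opprD addrA subrr add0r.
rewrite mulmxN mulNmx normFN -scalemxAr -scalemxAl normFZ ger0_norm ?sqr_ge0 //.
rewrite -(mulrA (sigma ^+ 2)) -(mulrA (sigma ^+ 2)) ler_wpM2l ?sqr_ge0 //.
exact: normFM3.
Qed.

Lemma normF_invgram_sub : normF (N%:R *: G - Ci) <= N%:R * b * dl * c.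
Proof.
have N_neq0 : N%:R != 0 :> R by rewrite pnatr_eq0 -lt0n.
have -> : N%:R *: G - Ci = - (N%:R *: (G *m Delta Phi Sigma *m Ci)).
  rewrite /Delta mulmxBr -scalemxAr mulVmx // mulmxBl -scalemxAl mul1mx.
  rewrite mulmxK ?posdef_unit // scalerBr scalerA divff // scale1r.
  by rewrite opprB.
rewrite normFN normFZ ger0_norm // -(mulrA N%:R) -(mulrA N%:R) ler_wpM2l //.
exact: normFM3.
Qed.

Lemma Fbar_sub_W_le (Y := Phi *m theta0 + V) :
  `|F_Sy_bar sigma Phi Y P - W_y sigma theta0 Sigma P|
  <= E1y sigma theta0 Phi V Sigma P + E2y sigma theta0 Phi Sigma P
     + E3y sigma theta0 Phi V Sigma P + E4y sigma theta0 Phi V Sigma P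
     + E5y sigma theta0 Phi V Sigma P.
Proof.
have [P_sym _] := posdef_inv P_pd; rewrite -/Pi in P_sym.
have [Si_sym _] := posdef_inv S_pd; rewrite -/Si in Si_sym.
have [G_sym _] := posdef_inv (posdef_gram Phi_rank); rewrite -/G in G_sym.
(* The noise part of the least squares estimate. *)
pose y := G *m (Phi^T *m V).
have thetaE : G *m Phi^T *m Y = theta0 + y.
  by rewrite /Y mulmxDr !mulmxA -(mulmxA G) mulVmx // mul1mx /y mulmxA.
pose M := Si *m G *m Si; pose L := Pi *m Ci *m Pi; pose K := N%:R *: M - L.
pose D := Ci *m Pi - N%:R *: (G *m Si).
have y_le : normF y <= b * v by exact: normFM.
have D1_le := normF_invS_sub; have D2_le := normF_invgram_sub.
have [b_ge0 s_ge0 p_ge0 c_ge0] :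
  [/\ 0 <= b, 0 <= s, 0 <= p & 0 <= c] by split; exact: normF_ge0.
have [th_ge0 v_ge0 dl_ge0] :
  [/\ 0 <= th, 0 <= v & 0 <= dl] by split; exact: normF_ge0.
have NG_le : normF (N%:R *: G) <= N%:R * b by rewrite normFZ ger0_norm.
set d1 := sigma ^+ 2 * s * b * p in D1_le.
set d2 := N%:R * b * dl * c in D2_le.
(* The three factors of S^-1 (N G) S^-1 are replaced one at a time by those of P^-1 Sigma^-1
   P^-1. *)
have K_le : normF K <= d1 * (N%:R * b) * s + p * d2 * s + p * c * d1.
  have -> : K = (Si - Pi) *m (N%:R *: G) *m Si + Pi *m (N%:R *: G - Ci) *m Si
             + Pi *m Ci *m (Si - Pi).
    rewrite /K /M /L !(mulmxBl, mulmxBr) -!(scalemxAl, scalemxAr).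
    by rewrite !addrA subrK subrK.
  apply: le_trans (normFD _ _) _; apply: lerD; last exact: normFM3.
  by apply: le_trans (normFD _ _) _; apply: lerD; exact: normFM3.
have D_le : normF D <= d2 * p + N%:R * b * d1.
  have -> : D = - ((N%:R *: G - Ci) *m Pi + N%:R *: G *m (Si - Pi)).
    rewrite /D !(mulmxBl, mulmxBr) -!(scalemxAl, scalemxAr) [in RHS]addrC.
    by rewrite addrA subrK opprB.
  rewrite normFN; apply: le_trans (normFD _ _) _; apply: lerD.
    by apply: le_trans (normFM _ _) _; rewrite ler_wpM2r.
  by apply: le_trans (normFM _ _) _; rewrite ler_pM ?normF_ge0.
(* [rank2] is by definition the rank of [D]. *)
have trD_le : `|\tr D| <= Num.sqrt (rank2 sigma Phi Sigma P)%:R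
                          * (d2 * p + N%:R * b * d1).
  by apply: le_trans (trace_le_rank _) _; rewrite ler_wpM2l ?sqrtr_ge0.
have M_le : normF M <= s * b * s by exact: normFM3.
have L_le : normF L <= p * c * p by exact: normFM3.
have M_sym : M^T = M by rewrite /M !trmx_mul Si_sym G_sym mulmxA.
have FWE : F_Sy_bar sigma Phi Y P - W_y sigma theta0 Sigma P
  = sigma ^+ 4 * (bform theta0 K theta0 + N%:R * bform theta0 M y
      + bform theta0 K y + bform theta0 L y + N%:R * bform y M y)
    + 2 * sigma ^+ 4 * \tr D.
  rewrite F_Sy_barE // -/G -/Si thetaE /W_y -/Pi -/Ci P_sym -/L -/M.
  have -> : \tr D = \tr (Ci *m Pi) - N%:R * \tr (G *m Si).
    by rewrite /D linearB linearZ.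
  rewrite !bformZB !bformDl !bformDr (bform_sym y theta0 M_sym).
  ring.
have xKx := abs_bform_le (lexx th) K_le (lexx th).
have xMy := abs_bform_le (lexx th) M_le y_le.
have xKy := abs_bform_le (lexx th) K_le y_le.
have xLy := abs_bform_le (lexx th) L_le y_le.
have yMy := abs_bform_le y_le M_le y_le.
have s4_ge0 : 0 <= sigma ^+ 4 by rewrite exprn_ge0 // ltW.
rewrite FWE; apply: le_trans (ler_normD _ _) _.
rewrite (normrM (2 * _)) (normrM (sigma ^+ 4)) (ger0_norm s4_ge0).
rewrite (ger0_norm (mulr_ge0 (ler0n _ 2) s4_ge0)).
have q_le : `|bform theta0 K theta0 + N%:R * bform theta0 M y
      + bform theta0 K y + bform theta0 L y + N%:R * bform y M y|
  <= th * (d1 * (N%:R * b) * s + p * d2 * s + p * c * d1) * th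
   + N%:R * (th * (s * b * s) * (b * v))
   + th * (d1 * (N%:R * b) * s + p * d2 * s + p * c * d1) * (b * v)
   + th * (p * c * p) * (b * v) + N%:R * (b * v * (s * b * s) * (b * v)).
  have N_norm (t u : R) : `|t| <= u -> `|N%:R * t| <= N%:R * u.
    by move=> t_le; rewrite normrM ger0_norm // ler_wpM2l.
  apply: le_trans (ler_normD _ _) (lerD _ (N_norm _ _ yMy)).
  apply: le_trans (ler_normD _ _) (lerD _ xLy).
  apply: le_trans (ler_normD _ _) (lerD _ xKy).
  exact: le_trans (ler_normD _ _) (lerD xKx (N_norm _ _ xMy)).
apply: le_trans (lerD (ler_wpM2l s4_ge0 q_le)
  (ler_wpM2l (mulr_ge0 (ler0n _ 2) s4_ge0) trD_le)) _.
(* The accumulated bound equals the sum of the five terms. E1 holds N x^T M y and x^T L y; E2 the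
   [d2] parts of x^T K x and of the trace; E3 their [d1] parts and N y^T M y; E4 and E5 the [d1] and
   [d2] parts of x^T K y. *)
rewrite le_eqVlt; apply/orP; left; apply/eqP.
rewrite /E1y /E2y /E3y /E4y /E5y !norm2E -/th -/v -/G -/b -/Si -/s.
rewrite -/Pi -/p -/Ci -/c -/dl.
rewrite /d1 /d2; ring.
Qed.

End ErrorBound.

(** * Monotonicity of the error terms in the matrix norms *)

Section TermBounds.
Variables (R : realType) (N n : nat) (sigma : R) (theta0 : 'cV[R]_n).
Variables (Phi : 'M[R]_(N, n)) (V : 'cV[R]_N) (Sigma P : 'M[R]_n).
Variables (beta dlt gam sg pi : R).
Hypothesis sigma_ge0 : 0 <= sigma.
Hypothesis b_le : normF (invmx (gram Phi)) <= beta.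
Hypothesis s_le : normF (invmx (Smx sigma Phi P)) <= sg.
Hypothesis c_le : normF (invmx Sigma) <= gam.
Hypothesis p_le : normF (invmx P) <= pi.
Let th := norm2 theta0.
Let v := norm2 (Phi^T *m V).
Let r := Num.sqrt (rank2 sigma Phi Sigma P)%:R : R.

Ltac nonneg :=
  repeat first [assumption | exact: normF_ge0 | exact: sqrtr_ge0
    | exact: ler0n | apply: mulr_ge0 | apply: exprn_ge0 | apply: addr_ge0].

(** Each error term is a polynomial with nonnegative coefficients in nonnegative quantities, so a
    comparison passes through sums, products and powers down to the individual norms. *)
Ltac monotone :=
  repeat first [exact: lexx | assumption | apply: lerD | apply: ler_pM
    | apply: lerXn2r; rewrite ?nnegrE];
  try solve [nonneg].

Let b0 : 0 <= beta := le_trans (normF_ge0 _) b_le.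
Let s0 : 0 <= sg := le_trans (normF_ge0 _) s_le.
Let c0 : 0 <= gam := le_trans (normF_ge0 _) c_le.
Let p0 : 0 <= pi := le_trans (normF_ge0 _) p_le.

Lemma E1y_le : E1y sigma theta0 Phi V Sigma P
  <= sigma ^+ 4 * th * v * beta * (N%:R * beta * sg ^+ 2 + gam * pi ^+ 2).
Proof. by rewrite /E1y; monotone. Qed.

Lemma E2y_le : normF (Delta Phi Sigma) <= dlt ->
  E2y sigma theta0 Phi Sigma P
  <= sigma ^+ 4 * N%:R * beta * dlt * gam * pi * (th ^+ 2 * sg + 2 * r).
Proof.
by move=> d_le; have d0 := le_trans (normF_ge0 _) d_le; rewrite /E2y; monotone.
Qed.

Lemma E3y_le : E3y sigma theta0 Phi V Sigma P
  <= sigma ^+ 4 * beta * sg *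
     (v ^+ 2 * N%:R * beta ^+ 2 * sg
      + sigma ^+ 2 * th ^+ 2 * N%:R * beta * sg * pi
      + sigma ^+ 2 * th ^+ 2 * gam * pi ^+ 2
      + 2 * r * sigma ^+ 2 * N%:R * beta * pi).
Proof. by rewrite /E3y; monotone. Qed.

Lemma E4y_le : E4y sigma theta0 Phi V Sigma P
  <= sigma ^+ 6 * th * v * beta ^+ 2 * sg * pi * (N%:R * beta * sg + gam * pi).
Proof. by rewrite /E4y; monotone. Qed.

Lemma E5y_le : normF (Delta Phi Sigma) <= dlt ->
  E5y sigma theta0 Phi V Sigma P
  <= sigma ^+ 4 * th * v * N%:R * beta ^+ 2 * dlt * gam * sg * pi.
Proof.
by move=> d_le; have d0 := le_trans (normF_ge0 _) d_le; rewrite /E5y; monotone.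
Qed.

End TermBounds.

(** * Assembly at a fixed sample size, outcome and hyper-parameter *)

Theorem theorem2 (d : measure_display) (T : measurableType d) (R : realType)
  (Pr : probability T R)
  (n p : nat) (n_ge2 : (2 <= n)%N)
  (sigma : R) (sigma_gt0 : 0 < sigma)
  (theta0 : 'cV[R]_n)
  (Phi : forall N : nat, T -> 'M[R]_(N, n))
  (Phi_meas : forall (N : nat) (i : 'I_N) (j : 'I_n),
     measurable_fun setT (fun w => Phi N w i j))
  (Phi_rank : forall N : nat, (n < N)%N -> forall w, \rank (Phi N w) = n)
  (noise : forall N : nat, 'I_N -> {RV Pr >-> R})
  (noise_iid : forall N : nat, (n < N)%N -> iid_noise sigma (@noise N))
  (V : forall N : nat, T -> 'cV[R]_N)
  (V_def : forall (N : nat) w, V N w = \col_i noise N i w)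
  (Y : forall N : nat, T -> 'cV[R]_N)
  (Y_def : forall (N : nat) w, Y N w = Phi N w *m theta0 + V N w)
  (Omega : set 'rV[R]_p) (P : 'rV[R]_p -> 'M[R]_n)
  (Sigma : 'M[R]_n) (delta : nat -> R)
  (eta_EB eta_Sy eta_EEB eta_MSEy : nat -> T -> 'rV[R]_p)
  (* A1 *)
  (A1_EB : forall N : nat, (n < N)%N -> {ae Pr, forall w,
     minimizers Omega (fun eta => F_EB sigma (Phi N w) (Y N w) (P eta))
       (eta_EB N w) /\ interior Omega (eta_EB N w)})
  (A1_Sy : forall N : nat, (n < N)%N -> {ae Pr, forall w,
     minimizers Omega (fun eta => F_Sy sigma (Phi N w) (Y N w) (P eta))
       (eta_Sy N w) /\ interior Omega (eta_Sy N w)})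
  (A1_EEB : forall N : nat, (n < N)%N -> {ae Pr, forall w,
     minimizers Omega (fun eta => F_EEB sigma (Phi N w) theta0 (P eta))
       (eta_EEB N w) /\ interior Omega (eta_EEB N w)})
  (A1_MSEy : forall N : nat, (n < N)%N -> {ae Pr, forall w,
     minimizers Omega (fun eta => F_MSEy sigma (Phi N w) theta0 (P eta))
       (eta_MSEy N w) /\ interior Omega (eta_MSEy N w)})
  (* A2 *)
  (A2_P : forall eta, Omega eta -> posdef (P eta))
  (A2_Sigma : posdef Sigma)
  (A2_cvg : {ae Pr, forall w,
     (fun N : nat => N%:R^-1 *: gram (Phi N w)) @ \oo --> Sigma})
  (* A3 *)
  (A3_b : minimizers Omega (fun eta => W_b theta0 (P eta)) `<=`
     isolated (minimizers Omega (fun eta => W_b theta0 (P eta))))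
  (A3_y : minimizers Omega (fun eta => W_y sigma theta0 Sigma (P eta)) `<=`
     isolated (minimizers Omega (fun eta => W_y sigma theta0 Sigma (P eta))))
  (* A4 *)
  (delta_neq0 : forall N : nat, (n < N)%N -> delta N != 0)
  (A4_delta : delta @ \oo --> (0 : R))
  (A4_Op : big_Op Pr n (fun N w => normF (Delta (Phi N w) Sigma)) delta) :
  forall N : nat, (n < N)%N -> forall (w : T) (eta : 'rV[R]_p), Omega eta ->
  let Pe := P eta in
  let A := gram (Phi N w) in
  let S := Smx sigma (Phi N w) Pe in
  let D := Delta (Phi N w) Sigma in
  let v := norm2 ((Phi N w)^T *m V N w) in
  let r2 := (rank2 sigma (Phi N w) Sigma Pe)%:R : R in
  let E1 := E1y sigma theta0 (Phi N w) (V N w) Sigma Pe in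
  let E2 := E2y sigma theta0 (Phi N w) Sigma Pe in
  let E3 := E3y sigma theta0 (Phi N w) (V N w) Sigma Pe in
  let E4 := E4y sigma theta0 (Phi N w) (V N w) Sigma Pe in
  let E5 := E5y sigma theta0 (Phi N w) (V N w) Sigma Pe in
  `|F_Sy_bar sigma (Phi N w) (Y N w) Pe - W_y sigma theta0 Sigma Pe|
    <= E1 + E2 + E3 + E4 + E5
  /\
  E1 <= 1 / Num.sqrt N%:R * n%:R ^+ 2 * sigma ^+ 4 * norm2 theta0
        * (N%:R / lambda A 1) * cond A * (v / Num.sqrt N%:R)
        * (N%:R / lambda A 1 * (1 / lambda S 1 ^+ 2) * cond A * cond S ^+ 2
           + 1 / lambda Sigma 1 * (1 / lambda Pe 1 ^+ 2)
             * cond Sigma * cond Pe ^+ 2)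
  /\
  (\det D != 0 ->
   E2 <= delta N * n%:R ^+ 2 * sigma ^+ 4
         * (N%:R / lambda A 1) * (lambda_abs D n / delta N)
         * (1 / lambda Sigma 1) * (1 / lambda Pe 1)
         * cond A * cond_abs D * cond Sigma * cond Pe
         * (Num.sqrt n%:R * norm2 theta0 ^+ 2 * (1 / lambda S 1) * cond S
            + 2 * Num.sqrt r2))
  /\
  E3 <= 1 / N%:R * n%:R ^+ 2 * sigma ^+ 4
        * (N%:R / lambda A 1) * (1 / lambda S 1) * cond A * cond S
        * (Num.sqrt n%:R * (v ^+ 2 / N%:R) * (N%:R / lambda A 1) ^+ 2
             * (1 / lambda S 1) * cond A ^+ 2 * cond S
           + Num.sqrt n%:R * sigma ^+ 2 * norm2 theta0 ^+ 2
             * (N%:R / lambda A 1) * (1 / lambda S 1) * (1 / lambda Pe 1)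
             * cond A * cond S * cond Pe
           + Num.sqrt n%:R * sigma ^+ 2 * norm2 theta0 ^+ 2
             * (1 / lambda Sigma 1) * (1 / lambda Pe 1 ^+ 2)
             * cond Sigma * cond Pe ^+ 2
           + 2 * Num.sqrt r2 * sigma ^+ 2
             * (N%:R / lambda A 1) * (1 / lambda Pe 1) * cond A * cond Pe)
  /\
  E4 <= 1 / (N%:R `^ (3 / 2)) * sigma ^+ 6 * n%:R ^+ 3 * norm2 theta0
        * (N%:R / lambda A 1) ^+ 2 * (1 / lambda S 1) * (1 / lambda Pe 1)
        * cond A ^+ 2 * cond S * cond Pe * (v / Num.sqrt N%:R)
        * (N%:R / lambda A 1 * (1 / lambda S 1) * cond A * cond S
           + 1 / lambda Sigma 1 * (1 / lambda Pe 1) * cond Sigma * cond Pe)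
  /\
  (\det D != 0 ->
   E5 <= delta N / Num.sqrt N%:R * sigma ^+ 4 * n%:R ^+ 3 * norm2 theta0
         * (N%:R / lambda A 1) ^+ 2 * (lambda_abs D n / delta N)
         * (1 / lambda Sigma 1) * (1 / lambda S 1) * (1 / lambda Pe 1)
         * cond A ^+ 2 * cond_abs D * cond Sigma * cond S * cond Pe
         * (v / Num.sqrt N%:R)).
Proof.
move=> N lt_nN w eta Omega_eta Pe A S D v r2 E1 E2 E3 E4 E5.
have n_gt0 : (0 < n)%N by exact: leq_trans n_ge2.
have N_gt0 : (0 < N)%N by exact: leq_ltn_trans lt_nN.
have rankN := Phi_rank N lt_nN w.
have P_pd : posdef Pe := A2_P eta Omega_eta.
have A_pd : posdef A := posdef_gram rankN.
have S_pd : posdef S := posdef_Smx sigma_gt0 rankN P_pd.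
have D_sym : D^T = D.
  by rewrite /D /Delta linearB linearZ /= A_pd.1 A2_Sigma.1.
have l_neq0 (B : 'M[R]_n) : posdef B -> lambda B 1 != 0.
  by move=> B_pd; rewrite gt_eqF // posdef_lambda_gt0.
have b_le := normF_invmx_le A_pd n_gt0.
have s_le := normF_invmx_le S_pd n_gt0.
have c_le := normF_invmx_le A2_Sigma n_gt0.
have p_le := normF_invmx_le P_pd n_gt0.
have dl_le := normF_le_cond_abs D_sym n_gt0.
have sigma_ge0 := ltW sigma_gt0.
(* Writing n and N as squares of their roots makes every half-integer power a polynomial in those
   roots. *)
have n_sqr : n%:R = Num.sqrt n%:R ^+ 2 :> R by rewrite sqr_sqrtr.
have N_sqr : N%:R = Num.sqrt N%:R ^+ 2 :> R by rewrite sqr_sqrtr.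
have N32 : N%:R `^ (3 / 2) = Num.sqrt N%:R ^+ 3 :> R.
  by rewrite -powR12_sqrt // -powR_mulrn ?powR_ge0 // -powRrM mulrC.
have q_neq0 : Num.sqrt N%:R != 0 :> R.
  by rewrite gt_eqF // sqrtr_gt0 ltr0n.
split; first by rewrite Y_def; exact: Fbar_sub_W_le.
have E1_le := E1y_le theta0 (V N w) sigma_ge0 b_le s_le c_le p_le.
have E2_le d_le := E2y_le theta0 sigma_ge0 b_le s_le c_le p_le (dl_le d_le).
have E3_le := E3y_le theta0 (V N w) sigma_ge0 b_le s_le c_le p_le.
have E4_le := E4y_le theta0 (V N w) sigma_ge0 b_le s_le c_le p_le.
have E5_le d_le := E5y_le theta0 (V N w) sigma_ge0 b_le s_le c_le p_le (dl_le d_le).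
rewrite -/r2 -/v -/E1 -/E2 -/E3 -/E4 -/E5 in E1_le E2_le E3_le E4_le E5_le.
rewrite N32; move: N_sqr n_sqr q_neq0 E1_le E2_le E3_le E4_le E5_le.
set q := Num.sqrt N%:R; set k := Num.sqrt n%:R => -> -> q_neq0.
(* From here on only real numbers matter; [field] would otherwise try to
   convert the matrix expressions into one another. *)
move: (delta_neq0 N lt_nN).
move: (l_neq0 _ A_pd) (l_neq0 _ S_pd) (l_neq0 _ A2_Sigma) (l_neq0 _ P_pd).
clearbody E1 E2 E3 E4 E5 v k q.
move: (Num.sqrt r2) (norm2 theta0) (delta N) (lambda_abs D n) (cond_abs D).
move: (lambda A 1) (lambda S 1) (lambda Sigma 1) (lambda Pe 1).
move: (cond A) (cond S) (cond Sigma) (cond Pe).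
move: (\det D != 0) E1 E2 E3 E4 E5 v k q q_neq0; clear - R.
move=> detD E1 E2 E3 E4 E5 v k q q_neq0 cA cS cC cP lA lS lC lP r th dl lD cD.
move=> lA_neq0 lS_neq0 lC_neq0 lP_neq0 dl_neq0 E1_le E2_le E3_le E4_le E5_le.
(* Once each norm is replaced by its spectral bound, the stated right-hand sides are equal to the
   results as rational functions; [delta N] cancels, being nonzero. *)
by split; [|split; [|split; [|split]]] => [|d_le||| d_le];
  [ apply: le_trans E1_le _ | apply: le_trans (E2_le d_le) _
  | apply: le_trans E3_le _ | apply: le_trans E4_le _
  | apply: le_trans (E5_le d_le) _ ];
  rewrite le_eqVlt; apply/orP; left; apply/eqP; field;
  rewrite ?lA_neq0 ?lS_neq0 ?lC_neq0 ?lP_neq0 ?dl_neq0 ?q_neq0.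
Qed.
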